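(* Let $k$, $k'$, $\ell$, and $t$ be positive integers. Then there exists $n_0 = n_0(k,k',\ell,t)$ such that for every integer $n \geq n_0$ the following holds. Suppose that two families $\mathcal{F} \subseteq \binom{[n]}{k}$ and $\mathcal{F}' \subseteq \binom{[n]}{k'}$ are $\ell$-weakly cross $t$-intersecting, that is, \[ \sum_{1 \leq i, j \leq \ell} \lvert F_i \cap F_j' \rvert \geq \ell^2 t - \ell + 1 \] for every choice of $\ell$ distinct members $F_1, \ldots, F_\ell \in \mathcal{F}$ and $\ell$ distinct members $F_1', \ldots, F_\ell' \in \mathcal{F}'$. Then \[ \lvert \mathcal{F} \rvert \cdot \lvert \mathcal{F}' \rvert \leq \binom{n-t}{k-t} \binom{n-t}{k'-t}. \]
   Context: For a positive integer $n$, $[n]=\{1,\dots,n\}$, and $\binom{[n]}{k}$ denotes the family of all $k$-element subsets of $[n]$.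
   Formalization: The formal theorem also assumes that each of the two families has at least ℓ members; otherwise the condition is vacuous and the bound can fail (k=k'=t=1, ℓ=2, F={{1}}, F' all singletons gives n > 1). *)

(* Defs.v *)
From mathcomp Require Import all_boot.

Set Implicit Arguments.
Unset Strict Implicit.
Unset Printing Implicit Defensive.

(* The ground set [n] is 'I_n, whose elements are numbered from 0. *)
Definition ksubsets (n k : nat) : {set {set 'I_n}} :=
  [set A : {set 'I_n} | #|A| == k].

(* Choices of l distinct members are injective families indexed by 'I_l.  For
   positive l and t we have l <= l ^ 2 * t, so the subtraction is exact.
   The condition is vacuous when F or F' has fewer than l members, whence the
   separate assumptions l <= #|F| and l <= #|F'| in the theorem. *)
Definition weakly_cross_intersecting (n l t : nat)
    (F F' : {set {set 'I_n}}) : Prop :=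
  forall A B : 'I_l -> {set 'I_n},
    injective A -> injective B ->
    (forall i, A i \in F) -> (forall j, B j \in F') ->
    l ^ 2 * t - l + 1 <= \sum_(i < l) \sum_(j < l) #|A i :&: B j|.

(* The binomial coefficient (n - t choose k - t) with its usual value 0 for
   k < t; a bare 'C(n - t, k - t) would be 1 there, subtraction on nat being
   truncated. *)
Definition shifted_bin (n k t : nat) : nat :=
  if t <= k then 'C(n - t, k - t) else 0.

(* Main.v *)
Require Import Defs.
From mathcomp Require Import all_boot.

(** If [l] members of [F] contain a [t]-set [T] and meet the union of [l]
    members [B_j] of [F'] only inside [T], the hypothesis reads
    [l * \sum_j #|T :&: B_j| >= l ^ 2 * t - l + 1], which forces [T] into every
    [B_j].  Such members of [F] exist, for all [B_j], as soon as [T] lies in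
    more than [O(n ^ (k - t - 1))] members of [F]; then all members of [F']
    contain [T] and [#|F'| <= 'C(n - t, k' - t)].

    On the other hand, given [A_1, ..., A_l] in [F], all but [l - 1] members
    [B] of [F'] satisfy [\sum_i #|A_i :&: B| >= l * t], hence contain one of
    the boundedly many [t]-subsets of the [A_i].  Thus
    [#|F'| = O(n ^ (k' - t))], and if no [t]-set has large degree in [F] then
    [#|F| = O(n ^ (k - t - 1))], so that the product is too small anyway. *)

(** * Choices of distinct members and counting estimates *)

(** Prescribing the value [x] is what later allows an arbitrary member of [F'] to be one of the
    chosen [B j]. *)
Lemma exists_injection_through {T : finType} {S : {set T}} {l : nat} {x : T} :
  0 < l <= #|S| -> x \in S ->
  exists f : 'I_l -> T,
    [/\ injective f, forall i, f i \in S & exists i, f i = x].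
Proof.
case/andP=> l_gt0 le_lS xS.
pose s := x :: enum (S :\ x).
have s_uniq : uniq s by rewrite /= mem_enum in_setD1 eqxx enum_uniq.
have s_size : size s = #|S| by rewrite /= -cardE (cardsD1 x S) xS.
have lt_s (i : 'I_l) : i < size s.
  by rewrite s_size; apply: leq_trans le_lS; apply: ltn_ord.
exists (fun i : 'I_l => nth x s i); split; last by exists (Ordinal l_gt0).
- by move=> i j /eqP; rewrite nth_uniq // => /eqP /val_inj.
- move=> i; have /= := mem_nth x (lt_s i).
  by rewrite in_cons mem_enum in_setD1 => /orP[/eqP-> // | /andP[]].
Qed.

Lemma exists_injection {T : finType} {S : {set T}} {l : nat} :
  0 < l <= #|S| ->
  exists2 f : 'I_l -> T, injective f & forall i, f i \in S.
Proof.
move=> lS; have /card_gt0P[x xS] : 0 < #|S|.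
  by case/andP: lS => l_gt0; apply: leq_trans.
by have [f [f_inj fS _]] := exists_injection_through lS xS; exists f.
Qed.

Lemma card_bigcup_le {I T : finType} {P : pred I} {U : I -> {set T}} (m : nat) :
  (forall i, P i -> #|U i| <= m) ->
  #|\bigcup_(i | P i) U i| <= #|[pred i | P i]| * m.
Proof.
move=> Um; apply: (@leq_trans (\sum_(i | P i) #|U i|)).
  elim/big_rec2: _ => [|i c V _ IH]; first by rewrite cards0.
  by apply: leq_trans (leq_card_setU _ _) _; rewrite leq_add2l.
by rewrite -sum_nat_const; apply: leq_sum.
Qed.

Lemma exists_subset_card {T : finType} (A : {set T}) (t : nat) :
  t <= #|A| -> exists2 B : {set T}, B \subset A & #|B| = t.
Proof.
move=> tA; have : 0 < #|[set B : {set T} | B \subset A & #|B| == t]|.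
  by rewrite cards_draws bin_gt0.
by case/card_gt0P=> B; rewrite inE => /andP[BA /eqP]; exists B.
Qed.

Lemma card_uniform_supersets {n k : nat} (F : {set {set 'I_n}}) (T : {set 'I_n}) :
  F \subset ksubsets n k -> (forall A, A \in F -> T \subset A) ->
  #|F| <= 'C(n - #|T|, k - #|T|).
Proof.
move=> Fk FT.
have -> : n - #|T| = #|~: T| by rewrite [in RHS]cardsCs setCK card_ord.
rewrite -cards_draws -(@card_in_imset _ _ (fun A => A :\: T) F).
  apply/subset_leq_card/subsetP=> _ /imsetP[A AF ->]; rewrite inE.
  have := subsetP Fk A AF; rewrite inE => /eqP <-.
  by rewrite cardsDS ?FT // eqxx andbT setDE subsetIr.
move=> A B AF BF /= eqAB.
by rewrite -(setID A T) -(setID B T) eqAB !(setIidPr _) ?FT.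
Qed.

(** Since [(k - t) * 'C(n - t, k - t) = (n - t) * 'C(n - t.+1, k - t.+1)], it suffices that
    [c * (k - t) <= n - t]. *)
Lemma bin_shift_dominates (k t c n : nat) :
  t < k -> c * k + t <= n -> c * 'C(n - t.+1, k - t.+1) <= 'C(n - t, k - t).
Proof.
move=> lt_tk le_n; have kt_gt0 : 0 < k - t by rewrite subn_gt0.
rewrite -(leq_pmul2l kt_gt0) -[k - t in X in _ <= X]prednK // !subnS.
rewrite -mul_bin_diag mulnA leq_mul2r; apply/orP; right.
rewrite leq_subRL ?(leq_trans (leq_addl _ _) le_n) // addnC.
apply: leq_trans le_n; rewrite leq_add2r mulnC leq_mul2l leq_subr.
exact: orbT.
Qed.

Lemma weakly_cross_intersecting_sym {n l t : nat} {F F' : {set {set 'I_n}}} :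
  weakly_cross_intersecting l t F F' -> weakly_cross_intersecting l t F' F.
Proof.
move=> FF' A B Ainj Binj AF BF.
apply: leq_trans (FF' B A Binj Ainj BF AF) _.
rewrite exchange_big /=.
by apply: leq_sum => i _; apply: leq_sum => j _; rewrite setIC.
Qed.

(** * Consequences of the weak intersection condition *)

Section WeaklyCross.

Context {n k k' l t : nat} {F F' : {set {set 'I_n}}}.
Hypotheses (l_gt0 : 0 < l) (t_gt0 : 0 < t).
Hypotheses (Fk : F \subset ksubsets n k) (F'k : F' \subset ksubsets n k').
Hypotheses (lF : l <= #|F|) (lF' : l <= #|F'|).
Hypothesis FF' : weakly_cross_intersecting l t F F'.

(** Otherwise take [l] deficient members as the [B j]: every column sum is at most [l * t - 1], so
    the total is at most [l ^ 2 * t - l], one short of the hypothesis. *)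
Lemma card_deficient (A : 'I_l -> {set 'I_n}) :
  injective A -> (forall i, A i \in F) ->
  #|[set B in F' | \sum_(i < l) #|A i :&: B| < l * t]| < l.
Proof.
move=> Ainj AF; rewrite ltnNge; apply/negP=> lD.
have /exists_injection[B Binj BD] := introT andP (conj l_gt0 lD).
have BF' j : B j \in F' by have := BD j; rewrite inE => /andP[].
have := FF' _ _ Ainj Binj AF BF'; rewrite exchange_big /= leqNgt => /negP; apply.
rewrite addn1 ltnS.
have -> : l ^ 2 * t - l = \sum_(j < l) (l * t).-1.
  by rewrite sum_nat_const card_ord -subn1 mulnBr muln1 mulnA.
apply: leq_sum => j _; have := BD j; rewrite inE => /andP[_ lt_lt].
by rewrite -ltnS prednK ?muln_gt0 ?l_gt0.
Qed.

Lemma exists_nondeficient (A : 'I_l -> {set 'I_n}) :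
  injective A -> (forall i, A i \in F) ->
  exists2 B, B \in F' & l * t <= \sum_(i < l) #|A i :&: B|.
Proof.
move=> Ainj AF; have := card_deficient _ Ainj AF.
set D := [set B in F' | _] => ltD.
have /subsetPn[B BF' BD] : ~~ (F' \subset D).
  apply/negP=> /subset_leq_card; apply/negP; rewrite -ltnNge.
  exact: leq_trans ltD lF'.
by exists B => //; move: BD; rewrite inE BF' -leqNgt.
Qed.

Lemma sum_ge_exists (A : 'I_l -> {set 'I_n}) B :
  l * t <= \sum_(i < l) #|A i :&: B| -> exists i, t <= #|A i :&: B|.
Proof.
move=> sumA; apply/existsP; rewrite -[X in is_true X]negbK negb_exists.
apply/forallP=> small; move: sumA; apply/negP; rewrite -ltnNge.
have le_sum : \sum_(i < l) #|A i :&: B| <= \sum_(i < l) t.-1.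
  apply: leq_sum => i _; have := small i.
  by rewrite -ltnNge => lt_t; rewrite -ltnS prednK.
apply: leq_ltn_trans le_sum _.
by rewrite sum_nat_const card_ord ltn_pmul2l // prednK.
Qed.

(** A non-deficient [B] meets some [A i] in at least [t] points. This rules out the zero branch of
    [shifted_bin]. *)
Lemma t_le_sizes : t <= k /\ t <= k'.
Proof.
have [|A Ainj AF] := @exists_injection _ F l _; first by rewrite l_gt0.
have [B BF' /(sum_ge_exists A B)[i le_t]] := exists_nondeficient _ Ainj AF.
have := subsetP Fk _ (AF i); have := subsetP F'k _ BF'.
rewrite !inE => /eqP <- /eqP <-; split; apply: leq_trans le_t _;
  apply: subset_leq_card; [exact: subsetIl | exact: subsetIr].
Qed.

Lemma card_le_of_degrees (D : nat) :
  (forall T : {set 'I_n}, #|T| = t -> #|[set B in F' | T \subset B]| <= D) ->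
  #|F'| <= l + 2 ^ (l * k) * D.
Proof.
move=> degD.
have [|A Ainj AF] := @exists_injection _ F l _; first by rewrite l_gt0.
pose X := \bigcup_(i < l) A i.
have cardX : #|X| <= l * k.
  apply: leq_trans (card_bigcup_le k _) _ => [i _|].
    by have := subsetP Fk _ (AF i); rewrite inE => /eqP ->.
  by rewrite leq_mul2r -[X in _ <= X]card_ord max_card orbT.
pose P (T : {set 'I_n}) := (T \subset X) && (#|T| == t).
(* The deficient members account for the term [l]. Any other member contains a [t]-subset of some
   [A i], hence of [X], and [X] has at most [2 ^ (l * k)] subsets. *)
have cover : F' \subset [set B in F' | \sum_(i < l) #|A i :&: B| < l * t]
    :|: \bigcup_(T | P T) [set B in F' | T \subset B].
  apply/subsetP=> B BF'; rewrite inE inE BF' /=.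
  case: ltnP => //= /(sum_ge_exists A)[i /(exists_subset_card _ _)[T TAB cT]].
  move: TAB; rewrite subsetI => /andP[TA TB].
  apply/bigcupP; exists T; last by rewrite inE BF'.
  by rewrite /P cT eqxx andbT (subset_trans TA) // bigcup_sup.
apply: leq_trans (subset_leq_card cover) _.
apply: leq_trans (leq_card_setU _ _) _.
apply: leq_add; first exact: ltnW (card_deficient _ Ainj AF).
apply: leq_trans (card_bigcup_le D _) _ => [T /andP[_ /eqP]|].
  exact: degD.
rewrite leq_mul2r; apply/orP; right.
apply: (@leq_trans (2 ^ #|X|)); last by rewrite leq_exp2l.
rewrite -card_powerset; apply: subset_leq_card; apply/subsetP=> T.
by rewrite !inE => /andP[].
Qed.

Lemma card_le_bin :
  k' <= n -> #|F'| <= (l + 2 ^ (l * k)) * 'C(n - t, k' - t).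
Proof.
move=> le_k'n; rewrite mulnDl.
apply: leq_trans (card_le_of_degrees 'C(n - t, k' - t) _) _.
  move=> T <-; apply: card_uniform_supersets => [|B]; last by rewrite inE => /andP[].
  by apply: subset_trans F'k; apply/subsetP=> B; rewrite inE => /andP[].
by rewrite leq_add2r leq_pmulr // bin_gt0 leq_sub2r.
Qed.

Lemma large_degree_subset (T : {set 'I_n}) : #|T| = t ->
  l + l * k' * 'C(n - t.+1, k - t.+1) <= #|[set A in F | T \subset A]| ->
  forall B, B \in F' -> T \subset B.
Proof.
move=> cT large B0 B0F'.
have [|B [Binj BF' [j0 Bj0]]] := exists_injection_through (l := l) _ B0F'.
  by rewrite l_gt0.
pose X := \bigcup_(j < l) B j.
have cardX : #|X| <= l * k'.
  apply: leq_trans (card_bigcup_le k' _) _ => [i _|].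
    by have := subsetP F'k _ (BF' i); rewrite inE => /eqP ->.
  by rewrite leq_mul2r -[X in _ <= X]card_ord max_card orbT.
pose S := [set A in F | T \subset A].
(* A member of [S] outside [hit] meets every [B j] only inside [T]. Those in [hit] contain [x |: T],
   of size [t.+1], for one of at most [l * k'] points [x], and the degree of [T] leaves [l] members
   outside. *)
pose hit := \bigcup_(x in X :\: T) [set A in S | x \in A].
have card_hit : #|hit| <= l * k' * 'C(n - t.+1, k - t.+1).
  apply: leq_trans (card_bigcup_le ('C(n - t.+1, k - t.+1)) _) _.
    move=> x; rewrite in_setD => /andP[xT _].
    have <- : #|x |: T| = t.+1 by rewrite cardsU1 xT cT.
    apply: card_uniform_supersets => [|A].
      apply: subset_trans Fk; apply/subsetP=> A.
      by rewrite inE => /andP[]; rewrite inE => /andP[].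
    rewrite inE => /andP[]; rewrite inE => /andP[_ TA] xA.
    by rewrite subUset sub1set xA.
  rewrite leq_mul2r; apply/orP; right; apply: leq_trans cardX.
  by apply: subset_leq_card; apply: subsetDl.
have [|A Ainj AS] := @exists_injection _ (S :\: hit) l _.
  rewrite l_gt0 /= cardsD; apply: (@leq_trans (#|S| - #|hit|)).
    rewrite leq_subRL; last first.
      by apply: leq_trans card_hit (leq_trans _ large); apply: leq_addl.
    by apply: leq_trans large; rewrite addnC leq_add2l.
  by rewrite leq_sub2l // subset_leq_card // subsetIr.
have AF i : A i \in F.
  by have := AS i; rewrite in_setD => /andP[_]; rewrite inE => /andP[].
have meet i j : #|A i :&: B j| <= #|T :&: B j|.
  apply: subset_leq_card; apply/subsetP=> x; rewrite !inE => /andP[xA xB].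
  rewrite xB andbT; apply: contraT => xT.
  have := AS i; rewrite in_setD => /andP[/negP nhit AiS]; case: nhit.
  apply/bigcupP; exists x; last by rewrite inE AiS.
  by rewrite in_setD xT; apply/bigcupP; exists j.
rewrite -Bj0; apply: contraT => nTB.
have := FF' _ _ Ainj Binj AF BF'; rewrite leqNgt => /negP; case.
rewrite addn1 ltnS.
have -> : l ^ 2 * t - l = \sum_(i < l) (l * t).-1.
  by rewrite sum_nat_const card_ord -subn1 mulnBr muln1 mulnA.
(* Each term of a row is at most [t], and the one at [j0] is smaller if [T] is not contained in
   [B j0]; so the row sum is below [l * t]. *)
apply: leq_sum => i _; rewrite -ltnS prednK ?muln_gt0 ?l_gt0 //.
have -> : l * t = \sum_(j < l) t by rewrite sum_nat_const card_ord.
rewrite (bigD1 j0) //= [X in _ < X](bigD1 j0) //= -addSn.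
have le_T j : #|T :&: B j| <= t by rewrite -cT subset_leq_card ?subsetIl.
apply: leq_add.
  apply: leq_ltn_trans (meet i j0) _; rewrite -[X in _ < X]cT.
  by apply: proper_card; rewrite properE subsetIl subsetI subxx.
by apply: leq_sum => j _; apply: leq_trans (meet i j) (le_T j).
Qed.

(** * Extremal cases with uniformity [t] *)

Lemma cross_intersecting_of_l1 (A B : {set 'I_n}) :
  l = 1 -> A \in F -> B \in F' -> t <= #|A :&: B|.
Proof.
move=> l1 AF BF'.
have inj1 (C : {set 'I_n}) : injective (fun _ : 'I_l => C).
  by rewrite l1 => i j _; rewrite !ord1.
have := FF' _ _ (inj1 A) (inj1 B) (fun=> AF) (fun=> BF').
by rewrite !sum_nat_const !card_ord l1 !mul1n subnK.
Qed.

(** The bound on [#|F'|] forces [l = 1], so every [A] in [F] meets the unique [t]-set [B] in [t]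
    points, that is, contains it. *)
Lemma card_le_of_singleton :
  t = k' -> #|F'| <= 1 -> #|F| <= 'C(n - t, k - t).
Proof.
move=> tk' F'1.
have l1 : l = 1 by apply/eqP; rewrite eqn_leq l_gt0 (leq_trans lF').
have /card_gt0P[B BF'] : 0 < #|F'| by apply: leq_trans lF'.
have cB : #|B| = t by have := subsetP F'k _ BF'; rewrite inE tk' => /eqP.
rewrite -cB; apply: card_uniform_supersets => // A AF.
apply/setIidPr/eqP; rewrite eqEcard subsetIr cB.
exact: cross_intersecting_of_l1.
Qed.

Lemma card_le1_of_sizes : t = k -> t = k' -> #|F'| <= 1.
Proof.
move=> tk tk'.
have eqAB (A B : {set 'I_n}) : A \in F -> B \in F' -> t <= #|A :&: B| -> A = B.
  move=> /(subsetP Fk) + /(subsetP F'k).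
  rewrite !inE -tk -tk' => /eqP cA /eqP cB le_t.
  have /eqP <- : A :&: B == A by rewrite eqEcard subsetIl cA.
  by apply/eqP; rewrite eqEcard subsetIr cB.
have [|A Ainj AF] := @exists_injection _ F l _; first by rewrite l_gt0.
have [B BF' sumB] := exists_nondeficient _ Ainj AF.
have le_t i : #|A i :&: B| <= t.
  have := subsetP Fk _ (AF i); rewrite inE -tk => /eqP <-.
  by rewrite subset_leq_card ?subsetIl.
(* The [l] intersections have sizes at most [t] and sum at least [l * t], so each equals [t]; all
   [A i] then coincide with [B], and injectivity gives [l = 1]. *)
have AB i : A i = B.
  apply: eqAB => //; rewrite leqNgt; apply/negP=> lt_t.
  move: sumB; apply/negP; rewrite -ltnNge.
  have -> : l * t = \sum_(j < l) t by rewrite sum_nat_const card_ord.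
  rewrite (bigD1 i) //= [X in _ < X](bigD1 i) //= -addSn.
  by apply: leq_add => //; apply: leq_sum.
have l1 : l = 1.
  apply/eqP; rewrite eqn_leq l_gt0 andbT -[l]card_ord -(card_imset _ Ainj).
  rewrite -(cards1 B); apply/subset_leq_card/subsetP=> _ /imsetP[i _ ->].
  by rewrite AB inE.
rewrite -(cards1 B); apply/subset_leq_card/subsetP=> C CF'.
have BF : B \in F by rewrite -(AB (Ordinal l_gt0)).
by rewrite inE (eqAB B C) // cross_intersecting_of_l1.
Qed.

End WeaklyCross.

(** * Bounding the product for large [n] *)

(** The coefficient of [k] is the product of the constants bounding [#|F'|] and [#|F|] when no
    [t]-set has large degree in [F]; adding [t] fits [bin_shift_dominates]. The summands [k] and
    [k'] keep the binomials positive. *)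
Definition threshold k k' l t :=
  (l + 2 ^ (l * k)) * (l + 2 ^ (l * k') * (l + l * k')) * k + t + k + k'.

Lemma small_product_or_star {n k k' l t : nat} {F F' : {set {set 'I_n}}} :
  0 < l -> 0 < t -> t < k -> threshold k k' l t <= n ->
  F \subset ksubsets n k -> F' \subset ksubsets n k' ->
  l <= #|F| -> l <= #|F'| -> weakly_cross_intersecting l t F F' ->
  #|F| * #|F'| <= 'C(n - t, k - t) * 'C(n - t, k' - t)
  \/ #|F'| <= 'C(n - t, k' - t).
Proof.
move=> l_gt0 t_gt0 lt_tk le_n Fk F'k lF lF' FF'.
have F'F := weakly_cross_intersecting_sym FF'.
pose D := l + l * k' * 'C(n - t.+1, k - t.+1).
have le_k'n : k' <= n by apply: leq_trans le_n; apply: leq_addl.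
have le_kn : k <= n.
  by apply: leq_trans le_n; apply: leq_trans (leq_addr _ _); apply: leq_addl.
have [|] :=
  boolP [exists T : {set 'I_n}, (#|T| == t) && (D <= #|[set A in F | T \subset A]|)].
  case/existsP=> T /andP[/eqP cT large]; right.
  rewrite -cT; apply: card_uniform_supersets => // B.
  exact: (large_degree_subset l_gt0 t_gt0 Fk F'k lF' FF' T cT large).
rewrite negb_exists => /forallP small; left.
(* Positivity lets the additive terms [l] be absorbed into multiples of the binomial. *)
have C_gt0 : 0 < 'C(n - t.+1, k - t.+1) by rewrite bin_gt0 leq_sub2r.
have le_F : #|F| <= (l + 2 ^ (l * k') * (l + l * k')) * 'C(n - t.+1, k - t.+1).
  apply: leq_trans (card_le_of_degrees l_gt0 t_gt0 F'k lF' F'F D _) _.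
    move=> T cT; have := small T.
    by rewrite cT eqxx /= -ltnNge => /ltnW.
  rewrite mulnDl leq_add ?leq_pmulr // -mulnA leq_mul2l; apply/orP; right.
  by rewrite mulnDl leq_add2r leq_pmulr.
apply: leq_trans (leq_mul le_F (card_le_bin l_gt0 t_gt0 Fk F'k lF FF' le_k'n)) _.
rewrite mulnA leq_mul2r; apply/orP; right; rewrite mulnC mulnA.
apply: bin_shift_dominates => //; apply: leq_trans le_n.
by rewrite /threshold -[X in _ <= X]addnA leq_addr.
Qed.

Lemma product_le_of_lt {n k k' l t : nat} {F F' : {set {set 'I_n}}} :
  0 < l -> 0 < t -> t < k -> threshold k k' l t + threshold k' k l t <= n ->
  F \subset ksubsets n k -> F' \subset ksubsets n k' ->
  l <= #|F| -> l <= #|F'| -> weakly_cross_intersecting l t F F' ->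
  #|F| * #|F'| <= 'C(n - t, k - t) * 'C(n - t, k' - t).
Proof.
move=> l_gt0 t_gt0 lt_tk le_n Fk F'k lF lF' FF'.
have F'F := weakly_cross_intersecting_sym FF'.
have le_n1 : threshold k k' l t <= n by apply: leq_trans le_n; apply: leq_addr.
have le_n2 : threshold k' k l t <= n by apply: leq_trans le_n; apply: leq_addl.
have [_ le_tk'] := t_le_sizes l_gt0 t_gt0 Fk F'k lF lF' FF'.
have [//|le_F'] :=
  small_product_or_star l_gt0 t_gt0 lt_tk le_n1 Fk F'k lF lF' FF'.
(* For [t = k'] the bound on [F'] reads [#|F'| <= 1]. For [t < k'] the dichotomy is applied again
   with the families exchanged, hence the sum of both thresholds. *)
move: le_tk'; rewrite leq_eqVlt => /orP[/eqP tk' | lt_tk'].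
  apply: leq_mul => //; move: le_F'; rewrite tk' subnn bin0 -tk'.
  exact: card_le_of_singleton l_gt0 t_gt0 Fk F'k lF' FF' tk'.
have [|le_F] := small_product_or_star l_gt0 t_gt0 lt_tk' le_n2 F'k Fk lF' lF F'F.
  by rewrite mulnC [X in _ <= X]mulnC.
exact: leq_mul.
Qed.

Theorem theorem1p2 (k k' l t : nat)
    (k_gt0 : 0 < k) (k'_gt0 : 0 < k') (l_gt0 : 0 < l) (t_gt0 : 0 < t) :
  exists n0 : nat, forall n : nat, n0 <= n ->
  forall F F' : {set {set 'I_n}},
    F \subset ksubsets n k -> F' \subset ksubsets n k' ->
    l <= #|F| -> l <= #|F'| ->
    weakly_cross_intersecting l t F F' ->
    #|F| * #|F'| <= shifted_bin n k t * shifted_bin n k' t.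
Proof.
exists (threshold k k' l t + threshold k' k l t) => n le_n F F' Fk F'k lF lF' FF'.
have F'F := weakly_cross_intersecting_sym FF'.
have [le_tk le_tk'] := t_le_sizes l_gt0 t_gt0 Fk F'k lF lF' FF'.
rewrite /shifted_bin le_tk le_tk'.
move: le_tk; rewrite leq_eqVlt => /orP[/eqP tk | lt_tk]; last first.
  exact: product_le_of_lt lF lF' FF'.
move: le_tk'; rewrite leq_eqVlt => /orP[/eqP tk' | lt_tk']; last first.
  rewrite mulnC [X in _ <= X]mulnC; apply: product_le_of_lt lF' lF F'F => //.
  by rewrite addnC.
(* Only [t = k = k'] remains, where both binomials are 1. *)
have F'1 := card_le1_of_sizes l_gt0 t_gt0 Fk F'k lF lF' FF' tk tk'.
apply: leq_mul; last by rewrite -tk' subnn bin0.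
exact: card_le_of_singleton l_gt0 t_gt0 Fk F'k lF' FF' tk' F'1.
Qed.
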